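(* Let $k,l\geq 1$ be integers with $\gcd(k,l)=1$, let $G=F^{k/l}(3)$ and let $w(3,k)=x_0^kx_1^kx_2^k\in G$. Then the normal closure of $w(3,k)$ in $G$ is equal to the derived subgroup of $G$. Thus $w(3,k)=1$ in $G$ if and only if $G$ is abelian. In particular, $G$ is not torsion-free.
   Context: For integers $k,l\geq 1$, $$F^{k/l}(3)=\langle x_0,x_1,x_2\mid x_i^l x_{i+1}^k=x_{i+2}^l\ (0\leq i<3)\rangle,$$ with subscripts taken modulo $3$. A group is torsion-free if it has no non-trivial element of finite order. *)

(* Defs.v *)
From HB Require Import structures.
From mathcomp Require Import all_boot.
From mathcomp Require Import boolp classical_sets.

Set Implicit Arguments.
Unset Strict Implicit.
Unset Printing Implicit Defensive.

Local Open Scope classical_set_scope.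
Local Open Scope group_scope.
Local Open Scope quotient_scope.

(* The letter (x, false) stands for x and (x, true) for its formal inverse.   *)
Notation word X := (seq (X * bool)).

Definition winv (X : Type) (u : word X) : word X :=
  rev [seq (a.1, ~~ a.2) | a <- u].

Definition wpow (X : Type) (x : X) (n : nat) : word X := nseq n (x, false).

Section Presentation.
Variables (X : choiceType) (R : word X -> word X -> Prop).

(* Equality of words in < X | u = v (R u v) >: the least congruence on the    *)
(* free monoid of words containing free cancellation and the relations.       *)
Inductive word_eq : word X -> word X -> Prop :=
| word_eq_refl u : word_eq u u
| word_eq_sym u v : word_eq u v -> word_eq v u
| word_eq_trans u v w : word_eq u v -> word_eq v w -> word_eq u w
| word_eq_cat u u' v v' :
    word_eq u u' -> word_eq v v' -> word_eq (u ++ v) (u' ++ v')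
| word_eq_cancel x b : word_eq [:: (x, b); (x, ~~ b)] [::]
| word_eq_rel u v : R u v -> word_eq u v.

Definition word_eqb : rel (word X) := fun u v => `[< word_eq u v >].

Lemma word_eqb_refl : reflexive word_eqb.
Proof. by move=> u; apply/asboolP/word_eq_refl. Qed.

Lemma word_eqb_sym : symmetric word_eqb.
Proof. by move=> u v; apply/asboolP/asboolP; apply: word_eq_sym. Qed.

Lemma word_eqb_trans : transitive word_eqb.
Proof.
by move=> v u w /asboolP uv /asboolP vw; apply/asboolP/(word_eq_trans uv vw).
Qed.

Canonical word_equiv :=
  EquivRel word_eqb word_eqb_refl word_eqb_sym word_eqb_trans.

Definition presgroup : Type := {eq_quot word_equiv}.
HB.instance Definition _ := Choice.on presgroup.

Definition wclass (u : word X) : presgroup := \pi_{eq_quot word_equiv} u.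
Definition wrepr (g : presgroup) : word X := repr (g : {eq_quot word_equiv}).

Lemma wreprK : cancel wrepr wclass.
Proof. exact: reprK. Qed.

Lemma wclassP u v : wclass u = wclass v <-> word_eq u v.
Proof.
split=> [/eqP|uv]; first by rewrite /wclass eqmodE => /asboolP.
by apply/eqP; rewrite /wclass eqmodE; apply/asboolP.
Qed.

Lemma wrepr_class u : word_eq (wrepr (wclass u)) u.
Proof. by apply/wclassP; rewrite wreprK. Qed.

Lemma winv_cat u v : winv (u ++ v) = winv v ++ winv u :> word X.
Proof. by rewrite /winv map_cat rev_cat. Qed.

Lemma winvK : involutive (@winv X).
Proof.
move=> u; rewrite /winv map_rev revK -map_comp -[RHS]map_id.
by apply: eq_map => -[x b] /=; rewrite negbK.
Qed.

Lemma word_eq_mulV u : word_eq (u ++ winv u) [::].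
Proof.
elim: u => [|[x b] u IH]; first exact: word_eq_refl.
rewrite -cat1s winv_cat catA -(catA _ u).
apply: (word_eq_trans (v := [:: (x, b)] ++ [::] ++ [:: (x, ~~ b)])).
  rewrite -catA; do 2?[apply: word_eq_cat => //]; exact: word_eq_refl.
exact: word_eq_cancel.
Qed.

Lemma word_eq_Vmul u : word_eq (winv u ++ u) [::].
Proof. by rewrite -{2}(winvK u); apply: word_eq_mulV. Qed.

Definition pres_one : presgroup := wclass [::].
Definition pres_mul (g h : presgroup) := wclass (wrepr g ++ wrepr h).
Definition pres_inv (g : presgroup) := wclass (winv (wrepr g)).

Fact pres_mulA : associative pres_mul.
Proof.
move=> f g h; apply/wclassP.
apply: (word_eq_trans (v := wrepr f ++ wrepr g ++ wrepr h)).
  by apply: word_eq_cat; [exact: word_eq_refl | exact: wrepr_class].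
rewrite catA; apply/word_eq_sym.
by apply: word_eq_cat; [exact: wrepr_class | exact: word_eq_refl].
Qed.

Fact pres_mul1 : left_id pres_one pres_mul.
Proof.
move=> g; rewrite -[RHS]wreprK; apply/wclassP.
by apply: (@word_eq_cat _ [::]); [exact: wrepr_class | exact: word_eq_refl].
Qed.

Fact pres_mulr1 : right_id pres_one pres_mul.
Proof.
move=> g; rewrite -[RHS]wreprK; apply/wclassP; rewrite -[X in word_eq _ X]cats0.
by apply: word_eq_cat; [exact: word_eq_refl | exact: wrepr_class].
Qed.

Fact pres_mulVr : left_inverse pres_one pres_inv pres_mul.
Proof.
move=> g; apply/wclassP/(word_eq_trans _ (word_eq_Vmul (wrepr g))).
by apply: word_eq_cat; [exact: wrepr_class | exact: word_eq_refl].
Qed.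

Fact pres_mulrV : right_inverse pres_one pres_inv pres_mul.
Proof.
move=> g; apply/wclassP/(word_eq_trans _ (word_eq_mulV (wrepr g))).
by apply: word_eq_cat; [exact: word_eq_refl | exact: wrepr_class].
Qed.

HB.instance Definition _ := isGroup.Build presgroup
  pres_mulA pres_mul1 pres_mulr1 pres_mulVr pres_mulrV.

Definition pgen (x : X) : presgroup := wclass [:: (x, false)].

Lemma wclass_cat u v : wclass (u ++ v) = wclass u * wclass v.
Proof. by apply/wclassP/word_eq_sym/word_eq_cat; apply: wrepr_class. Qed.

Lemma wclass_nil : wclass [::] = 1.
Proof. by []. Qed.

Lemma wclass_inv u : wclass (winv u) = (wclass u)^-1.
Proof.
apply: (@mulIg _ (wclass u)); rewrite -wclass_cat mulVg -wclass_nil.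
exact/wclassP/word_eq_Vmul.
Qed.

Lemma wclass_pow x n : wclass (wpow x n) = pgen x ^+ n.
Proof.
elim: n => [|n IH]; first by rewrite expg0.
by rewrite expgS -IH -wclass_cat.
Qed.

Lemma pgen_relation u v : R u v -> wclass u = wclass v.
Proof. by move=> Ruv; apply/wclassP/word_eq_rel. Qed.

End Presentation.

Arguments pgen {X R} x.

Section Evaluation.
Variables (X : choiceType) (H : groupType) (f : X -> H).

Definition weval (u : word X) : H :=
  foldr (fun a h => (if a.2 then (f a.1)^-1 else f a.1) * h) 1 u.

Lemma weval_cat u v : weval (u ++ v) = weval u * weval v.
Proof. by elim: u => [|a u IH] /=; rewrite ?mul1g // IH mulgA. Qed.

Lemma weval_word_eq R (fR : forall u v, R u v -> weval u = weval v) u v :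
  word_eq R u v -> weval u = weval v.
Proof.
elim=> {u v} [//|//|u v w _ -> //|u u' v v' _ IHu _ IHv|x b|u v /fR //].
  by rewrite !weval_cat IHu IHv.
by case: b => /=; rewrite mulg1 ?mulVg ?mulgV.
Qed.

(* von Dyck: f extends to a morphism as soon as it respects the relations.    *)
Lemma presgroup_lift R (fR : forall u v, R u v -> weval u = weval v) :
  exists2 F : presgroup R -> H,
    {morph F : g h / g * h} & forall x, F (pgen x) = f x.
Proof.
exists (fun g => weval (wrepr g)) => [g h|x].
  by rewrite -weval_cat; apply: (weval_word_eq fR); apply: wrepr_class.
rewrite (weval_word_eq fR (wrepr_class _ _)) /=; exact: mulg1.
Qed.

End Evaluation.

Section GroupNotions.
Variable G : groupType.

Definition subgroup (A : set G) : Prop := group_closed [in A].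

Definition normal_subgroup (A : set G) : Prop :=
  subgroup A /\ forall x y, A x -> A (x ^ y).

Definition normal_closure (S : set G) : set G := smallest normal_subgroup S.

Definition derived_subgroup : set G :=
  smallest subgroup [set z | exists x y : G, z = [~ x, y]].

Definition is_abelian : Prop := forall x y : G, x * y = y * x.

Definition finite_order (x : G) : Prop := exists2 n, (0 < n)%N & x ^+ n = 1.

Definition torsion_free : Prop := forall x : G, finite_order x -> x = 1.

Lemma subgroupP (A : set G) :
  subgroup A <-> [/\ A 1, forall x y, A x -> A y -> A (x * y)
                   & forall x, A x -> A x^-1].
Proof.
have AE x : (x \in [in A]) = (x \in A) by [].
split=> [sA|[A1 AM AV]]; last first.
  split=> [|x y]; first by rewrite AE; apply/mem_set.
  by rewrite !AE => /set_mem Ax /set_mem Ay; apply/mem_set/AM => //; apply: AV.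
split=> [|x y Ax Ay|x Ax]; apply/set_mem.
- exact: sA.1.
- by apply: (group_closedM sA); rewrite AE; apply/mem_set.
- by apply: (group_closedV sA); rewrite AE; apply/mem_set.
Qed.

End GroupNotions.

Arguments derived_subgroup G : clear implicits.
Arguments is_abelian G : clear implicits.
Arguments torsion_free G : clear implicits.

(* ordS is the successor on 'I_3 modulo 3.                                    *)
Definition fib_rel (k l : nat) (u v : word 'I_3) : Prop :=
  exists i : 'I_3, u = wpow i l ++ wpow (ordS i) k /\ v = wpow (ordS (ordS i)) l.

Definition fibgroup (k l : nat) : groupType := presgroup (fib_rel k l).

Definition fibx (k l : nat) (i : 'I_3) : fibgroup k l := pgen i.

Lemma fibx_rel k l (i : 'I_3) :
  fibx k l i ^+ l * fibx k l (ordS i) ^+ k = fibx k l (ordS (ordS i)) ^+ l.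
Proof.
by rewrite -!wclass_pow -wclass_cat; apply: pgen_relation; exists i.
Qed.

Definition fibw (k l : nat) : fibgroup k l :=
  fibx k l (inord 0) ^+ k * fibx k l (inord 1) ^+ k * fibx k l (inord 2) ^+ k.

(* Main.v *)
Require Import Defs.
From mathcomp Require Import all_boot zmodp zify.
From mathcomp Require Import boolp classical_sets.

(** Put a_i = x_i^l and b_i = x_i^k, so that a_i b_(i+1) = a_(i+2) and a_i
    commutes with b_i. Multiplying the relations gives b_2 b_1 b_0 = 1, hence
    w = b_0 b_1 b_2 is a commutator of b_0 and b_1. Modulo w the b_i commute
    with each other, then with the a_i, and then the a_i commute with each
    other; since k and l are coprime, the x_i commute. For torsion: conjugation
    by the a_i forces w^2 = 1, so w is a torsion element unless w = 1. In that
    case G is abelian and x_0 has order dividing k (k^2 + 3 l^2), while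
    (x_0, x_1, x_2) |-> (k + l, - 2 l, l - k) defines a morphism to
    Z/(k^2 + 3 l^2) which is nontrivial on x_0. *)

Set Implicit Arguments.
Unset Strict Implicit.
Unset Printing Implicit Defensive.

Local Open Scope group_scope.

(** * Normal closures and derived subgroups *)

Section NormalSubgroups.
Variable G : groupType.

Lemma subgroup_smallest (S : set G) : subgroup (smallest (@subgroup G) S).
Proof.
apply/subgroupP; split=> [A [/subgroupP[]]//|x y Sx Sy A AS|x Sx A AS].
  by have /subgroupP[_ + _] := AS.1; apply; [apply: Sx | apply: Sy].
by have /subgroupP[_ _] := AS.1; apply; apply: Sx.
Qed.

Lemma normal_normal_closure (S : set G) : normal_subgroup (normal_closure S).
Proof.
split=> [|x y Sx A AS]; last by apply: AS.1.2; apply: Sx.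
apply/subgroupP; split=> [A [[/subgroupP[]]]//|x y Sx Sy A AS|x Sx A AS].
  by have /subgroupP[_ + _] := AS.1.1; apply; [apply: Sx | apply: Sy].
by have /subgroupP[_ _] := AS.1.1; apply; apply: Sx.
Qed.

Lemma derived_subgroup_comm (x y : G) : derived_subgroup G [~ x, y].
Proof. by apply: sub_gen_smallest; exists x, y. Qed.

Lemma derived_subgroup_sub (A : set G) :
  subgroup A -> (forall x y, A [~ x, y]) -> (derived_subgroup G `<=` A)%classic.
Proof. by move=> sA cA; apply: smallest_sub => // _ [x [y ->]]. Qed.

(** For fixed [y], the elements whose conjugate by [y] is in the derived subgroup form a subgroup
    containing all commutators. *)
Lemma normal_derived_subgroup : normal_subgroup (derived_subgroup G).
Proof.
have sD : subgroup (derived_subgroup G) by apply: subgroup_smallest.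
split=> // x y.
pose A := [set z | derived_subgroup G (z ^ y)]%classic.
suff: (derived_subgroup G `<=` A)%classic by apply.
have /subgroupP[D1 DM DV] := sD; apply: derived_subgroup_sub => [|u v].
  apply/subgroupP; rewrite /A /=; split=> [|u v|u]; first by rewrite conj1g.
  - by rewrite conjMg; apply: DM.
  - by rewrite conjVg; apply: DV.
by rewrite /A /= conjRg; apply: derived_subgroup_comm.
Qed.

Lemma derived_subgroup_abelian :
  derived_subgroup G = [set 1]%classic <-> is_abelian G.
Proof.
split=> [D1 x y|abG].
  by apply/commgP/eqP; have := derived_subgroup_comm x y; rewrite D1.
apply/seteqP; split=> [|_ ->]; last first.
  by have /subgroupP[] := normal_derived_subgroup.1.
apply: derived_subgroup_sub => [|x y]; last exact/eqP/commgP/abG.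
apply/subgroupP; split=> //= [x y -> ->|x ->]; first exact: mulg1.
exact: invg1.
Qed.

Lemma normal_closure1 (x : G) :
  normal_closure [set x]%classic = [set 1]%classic <-> x = 1.
Proof.
split=> [N1|->].
  have: normal_closure [set x]%classic x by apply: sub_gen_smallest.
  by rewrite N1.
apply: smallest_id; split=> [|y z ->]; last exact: conj1g.
apply/subgroupP; split=> //= [y z -> ->|y ->]; first exact: mulg1.
exact: invg1.
Qed.

(** * Commutation modulo a normal subgroup *)

Section CommuteModulo.
Variable (N : set G).
Hypothesis nN : normal_subgroup N.

(** Commutation of the images in G / N, without forming the quotient. *)
Definition commute_mod (x y : G) : Prop := N [~ x, y].

Lemma commute_modW x y : commute x y -> commute_mod x y.
Proof.
by move=> /commgP/eqP; rewrite /commute_mod => ->; have /subgroupP[] := nN.1.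
Qed.

Lemma commute_mod_sym x y : commute_mod x y -> commute_mod y x.
Proof.
have /subgroupP[_ _ NV] := nN.1.
by move=> /NV; rewrite /commute_mod /commg /conjg !gnorm.
Qed.

(** [x, y z] = [x, z] [x, y]^z. *)
Lemma commute_modM x y z :
  commute_mod x y -> commute_mod x z -> commute_mod x (y * z).
Proof.
have /subgroupP[_ NM _] := nN.1.
move=> xy xz; have := NM _ _ xz (nN.2 _ z xy).
by rewrite /commute_mod /commg /conjg !gnorm.
Qed.

(** [x, y^-1] is the conjugate of [x, y]^-1 by y^-1. *)
Lemma commute_modV x y : commute_mod x y -> commute_mod x y^-1.
Proof.
have /subgroupP[_ _ NV] := nN.1.
move=> /NV xy; have := nN.2 _ y^-1 xy.
by rewrite /commute_mod /commg /conjg !gnorm.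
Qed.

Lemma commute_modX x y n : commute_mod x y -> commute_mod x (y ^+ n).
Proof.
move=> xy; elim: n => [|n IHn]; first exact/commute_modW/commute1.
by rewrite expgS; apply: commute_modM.
Qed.

Lemma commute_mod_coprime x y k l : 0 < k -> coprime k l ->
  commute_mod x (y ^+ k) -> commute_mod x (y ^+ l) -> commute_mod x y.
Proof.
move=> k_gt0 /eqP kl xk xl.
(* Bezout with natural coefficients: u k = v l + 1. *)
have [u v uv _] := egcdnP l k_gt0.
have ->: y = (y ^+ l ^+ v)^-1 * y ^+ k ^+ u.
  by rewrite -!expgnA mulnC [(k * _)%N]mulnC uv kl expgnDr expg1 mulKg.
by apply: commute_modM; [apply: commute_modV|]; apply: commute_modX.
Qed.

End CommuteModulo.
End NormalSubgroups.

(** * Consequences of the relations between the a_i and the b_i *)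

Section FibonacciTriple.
Variables (G : groupType) (a0 a1 a2 b0 b1 b2 : G).
Hypotheses (ab0 : commute a0 b0) (ab1 : commute a1 b1) (ab2 : commute a2 b2).
Hypotheses (r0 : a0 * b1 = a2) (r1 : a1 * b2 = a0) (r2 : a2 * b0 = a1).

Lemma fib_b_rev_prod : b2 * b1 * b0 = 1.
Proof. by apply: (mulgI a1); rewrite mulg1 !mulgA r1 r0 r2. Qed.

Lemma fib_b2E : b2 = b0^-1 * b1^-1.
Proof.
by apply: (mulIg b1); apply: (mulIg b0); rewrite fib_b_rev_prod !gnorm.
Qed.

Lemma fib_b_prodE : b0 * b1 * b2 = [~ b0^-1, b1^-1].
Proof. by rewrite fib_b2E /commg /conjg !gnorm. Qed.

Lemma fib_b_prod_sqr : (b0 * b1 * b2) ^+ 2 = 1.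
Proof.
(* [b0] commutes with a0 = a1 b2, so [a1] acts on it as b2^-1 does. *)
have E0 : b0 ^ a1 = b2 * b0 * b2^-1.
  by apply: (mulgI a1); rewrite -conjgC !mulgA r1 ab0 -r1 !gnorm.
have E1 : b1 ^ a1 = b1 by apply/conjg_fixP/commgP/commute_sym.
(* [b2] commutes with a2 = a1 b0^-1, so [a1] acts on it as [b0] does. *)
have E2 : b2 ^ a1 = b0^-1 * b2 * b0.
  have e : a2 = a1 * b0^-1 by rewrite -r2 mulgK.
  have : b2 ^ a2 = b2 by apply/conjg_fixP/commgP/commute_sym.
  rewrite e conjgM => /(congr1 (conjg^~ b0)).
  by rewrite conjgKV => ->; rewrite /conjg !mulgA.
have := congr1 (conjg^~ a1) fib_b_rev_prod.
rewrite /= !conjMg E0 E1 E2 conj1g => E.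
have {}E : b2 * b0 * b1 * b2 = b0 * b2 * b0^-1.
  apply: (mulgI b0^-1); apply: (mulIg (b0 * b2^-1)).
  by rewrite !mulgA in E *; rewrite E !gnorm.
(* The square becomes b0 b1 b0 b2 b0^-1, which cancels on substituting b2 = b0^-1 b1^-1. *)
by rewrite expg2 -!mulgA (mulgA b2) (mulgA (b2 * b0)) E {1}fib_b2E !gnorm.
Qed.

(** Follows from b2 = b0^-1 b1^-1, a0 = a1 b2 and a1 = a0 b2^-1. The claim on [b1] and [b2] allows
    the indices to be rotated. *)
Lemma fib_commute_mod (N : set G) : normal_subgroup N -> commute_mod N b0 b1 ->
  commute_mod N b1 b2 /\
  [/\ commute_mod N a0 a1, commute_mod N a0 b1 & commute_mod N b0 a1].
Proof.
move=> nN c01; have c10 := commute_mod_sym nN c01.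
have cM := commute_modM nN; have cV := commute_modV nN.
have cS := commute_mod_sym nN; have cW := commute_modW nN.
have c02 : commute_mod N b0 b2.
  by rewrite fib_b2E; apply: (cM); apply: cV => //; apply: cW.
have c12 : commute_mod N b1 b2.
  by rewrite fib_b2E; apply: (cM); apply: cV => //; apply: cW.
have a0b1 : commute_mod N a0 b1.
  by apply: (cS); rewrite -r1; apply: (cM) => //; apply/cW/commute_sym.
have a0b2 : commute_mod N a0 b2.
  by rewrite fib_b2E; apply: (cM); apply: cV => //; apply: cW.
have a1E : a1 = a0 * b2^-1 by rewrite -r1 mulgK.
split=> //; split=> //; rewrite a1E; apply: (cM); try exact: cV.
  exact: cW.
by apply/cW/commute_sym.
Qed.

End FibonacciTriple.

(** * The relations between powers of three elements of any group *)

Section FibonacciRelations.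
Variables (G : groupType) (k l : nat).

Definition fib_triple (x0 x1 x2 : G) : Prop :=
  [/\ x0 ^+ l * x1 ^+ k = x2 ^+ l, x1 ^+ l * x2 ^+ k = x0 ^+ l
    & x2 ^+ l * x0 ^+ k = x1 ^+ l].

Lemma fib_triple_rot x0 x1 x2 : fib_triple x0 x1 x2 -> fib_triple x1 x2 x0.
Proof. by case. Qed.

Variables (x0 x1 x2 : G).
Hypothesis fibx : fib_triple x0 x1 x2.

Let commXX (x : G) : commute (x ^+ l) (x ^+ k).
Proof. exact/commuteX2/commute_refl. Qed.

Lemma fib_triple_rev_prod : x2 ^+ k * x1 ^+ k * x0 ^+ k = 1.
Proof. by have [r0 r1 r2] := fibx; apply: fib_b_rev_prod r0 r1 r2. Qed.

Lemma fib_triple_prodE :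
  x0 ^+ k * x1 ^+ k * x2 ^+ k = [~ (x0 ^+ k)^-1, (x1 ^+ k)^-1].
Proof. by have [r0 r1 r2] := fibx; apply: fib_b_prodE r0 r1 r2. Qed.

Lemma fib_triple_prod_sqr : (x0 ^+ k * x1 ^+ k * x2 ^+ k) ^+ 2 = 1.
Proof. by have [r0 r1 r2] := fibx; apply: fib_b_prod_sqr r0 r1 r2. Qed.

Lemma fib_triple_commute_mod (N : set G) : 0 < k -> coprime k l ->
    normal_subgroup N -> commute_mod N (x0 ^+ k) (x1 ^+ k) ->
  commute_mod N (x1 ^+ k) (x2 ^+ k) /\ commute_mod N x0 x1.
Proof.
move=> k_gt0 kl nN c01; have [r0 r1 r2] := fibx.
have [c12 [a01 ab ba]] :=
  fib_commute_mod (commXX _) (commXX _) r0 r1 r2 nN c01.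
split=> //; have cC := commute_mod_coprime nN k_gt0 kl.
by apply: (commute_mod_sym nN); apply: (cC); apply: (commute_mod_sym nN);
  apply: (cC).
Qed.

(** Additively, (k^2 + 3 l^2) x0 = l^2 (x0 + x1 + x2), while k (x0 + x1 + x2) = 0. *)
Lemma fib_triple_finite_order :
  is_abelian G -> x0 ^+ (k * (k ^ 2 + 3 * l ^ 2)) = 1.
Proof.
move=> abG; have [r0 r1 r2] := fibx.
have mulCA (x y z : G) : x * (y * z) = y * (x * z).
  by rewrite !mulgA (abG x).
have XM (x y : G) n : (x * y) ^+ n = x ^+ n * y ^+ n by apply/expgMn/abG.
have X (x : G) m n : x ^+ m ^+ n = x ^+ n ^+ m by apply: expgnAC.
(* The first two relations are raised to the power [l], the third to the power [k]. *)
have e0 : x0 ^+ l ^+ l * x1 ^+ k ^+ l = x2 ^+ l ^+ l by rewrite -XM r0.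
have e1 : x1 ^+ l ^+ l * x2 ^+ k ^+ l = x0 ^+ l ^+ l by rewrite -XM r1.
have e2 : x2 ^+ k ^+ l * x0 ^+ k ^+ k = x1 ^+ k ^+ l.
  by rewrite X (X x1) -XM r2.
have eS : x0 ^+ k ^+ k * x0 ^+ l ^+ l ^+ 3 = (x2 * x1 * x0) ^+ l ^+ l.
  rewrite !XM -e0 -e2 2!expgS expg1 -{3}e1.
  rewrite -!mulgA mulCA; congr (_ * _).
  rewrite [RHS]mulCA; congr (_ * _).
  by rewrite [RHS]abG (abG (x1 ^+ l ^+ l) (x0 ^+ l ^+ l)) mulgA.
have eX : x0 ^+ (k ^ 2 + 3 * l ^ 2) = x0 ^+ k ^+ k * x0 ^+ l ^+ l ^+ 3.
  by rewrite expgnDr -!expgnA [(3 * _)%N]mulnC -!mulnn !mulnA.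
have Sk1 : (x2 * x1 * x0) ^+ k = 1 by rewrite !XM fib_triple_rev_prod.
by rewrite mulnC expgnA eX eS (X _ l k) (X _ l k) Sk1 !expg1n.
Qed.

End FibonacciRelations.

(** * Reduction to the generators of a presented group *)

Lemma presgroup_gen_ind (X : choiceType) (R : word X -> word X -> Prop)
    (A : set (presgroup R)) :
  subgroup A -> (forall x, A (pgen x)) -> forall g, A g.
Proof.
move=> /subgroupP[A1 AM AV] Agen g; rewrite -[g]wreprK.
elim: (wrepr g) => [|[x b] u IHu]; first exact: A1.
rewrite -cat1s wclass_cat; apply: AM => //.
case: b; last exact: Agen.
by have := AV _ (Agen x); rewrite -wclass_inv.
Qed.

(** The elements commuting with a fixed [g] modulo [N] form a subgroup, so generators suffice in
    each argument. *)
Lemma presgroup_commute_mod (X : choiceType) (R : word X -> word X -> Prop)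
    (N : set (presgroup R)) : normal_subgroup N ->
  (forall x y : X, commute_mod N (pgen x) (pgen y)) ->
  forall g h, commute_mod N g h.
Proof.
move=> nN cN.
have sC g : subgroup (commute_mod N g).
  apply/subgroupP; split; first exact/(commute_modW nN)/commute1.
    exact: commute_modM.
  exact: commute_modV.
move=> g; apply: presgroup_gen_ind => // x; apply: (commute_mod_sym nN).
by apply: presgroup_gen_ind g.
Qed.

Lemma weval_wpow (X : choiceType) (H : groupType) (f : X -> H) x n :
  weval f (wpow x n) = f x ^+ n.
Proof. by elim: n => //= n ->; rewrite expgS. Qed.

(** * The group [fibgroup k l] and its map to a cyclic group *)

Section FibonacciGroup.
Variables k l : nat.

Let x i := fibx k l (inord i).

Lemma fibgroup_triple : fib_triple k l (x 0) (x 1) (x 2).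
Proof.
have o0 : ordS (inord 2 : 'I_3) = inord 0 by apply: val_inj; rewrite /= !inordK.
have o1 : ordS (inord 0 : 'I_3) = inord 1 by apply: val_inj; rewrite /= !inordK.
have o2 : ordS (inord 1 : 'I_3) = inord 2 by apply: val_inj; rewrite /= !inordK.
by split; [have := fibx_rel k l (inord 0) | have := fibx_rel k l (inord 1)
  | have := fibx_rel k l (inord 2)]; rewrite ?(o0, o1, o2).
Qed.

Lemma fibw_sqr : fibw k l ^+ 2 = 1.
Proof. exact: fib_triple_prod_sqr fibgroup_triple. Qed.

Lemma fibwE : fibw k l = [~ (x 0 ^+ k)^-1, (x 1 ^+ k)^-1].
Proof. exact: fib_triple_prodE fibgroup_triple. Qed.

(** Rotating the triple propagates commutation from one pair of generators to all pairs. *)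
Lemma fibgroup_commute_mod (N : set (fibgroup k l)) : 0 < k -> coprime k l ->
  normal_subgroup N -> N (fibw k l) -> forall g h, commute_mod N g h.
Proof.
move=> k_gt0 kl nN; rewrite fibwE => wN.
have t0 := fibgroup_triple.
have t1 := fib_triple_rot t0; have t2 := fib_triple_rot t1.
have cV := commute_modV nN; have cS := commute_mod_sym nN.
have b01 : commute_mod N (x 0 ^+ k) (x 1 ^+ k).
  rewrite -[x 0 ^+ k]invgK -[x 1 ^+ k]invgK.
  by apply/cV/cS/cV/cS.
have [b12 c01] := fib_triple_commute_mod t0 k_gt0 kl nN b01.
have [b20 c12] := fib_triple_commute_mod t1 k_gt0 kl nN b12.
have [_ c20] := fib_triple_commute_mod t2 k_gt0 kl nN b20.
have cW (i : nat) : commute_mod N (x i) (x i).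
  by apply: commute_modW => //; apply: commute_refl.
apply: presgroup_commute_mod => // i j.
rewrite -/(fibx k l i) -/(fibx k l j) -[i]inord_val -[j]inord_val.
by case: i j => [[|[|[|i]]] ?] [[|[|[|j]]] ?] //=;
  do [exact: cW | exact: c01 | exact: c12 | exact: c20 | exact: cS].
Qed.

Lemma fibx0_neq1 : 0 < k -> 0 < l -> x 0 <> 1.
Proof.
move=> k_gt0 l_gt0.
have [m mE] : exists m, m = (k * k + 3 * (l * l))%N by eexists.
(* These bounds give k + l < m and 2 l <= m, so the truncated subtractions below are exact. *)
have k_le : (k <= k * k)%N by rewrite leq_pmulr.
have l_le : (l <= l * l)%N by rewrite leq_pmulr.
have m_gt0 : 0 < m by lia.
(* The integers p and q represent - 2 l and l - k modulo m. *)
have [p pE] : exists p, (p + 2 * l = m)%N by exists (m - 2 * l)%N; lia.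
have [q qE] : exists q, (q + k = l + m)%N by exists (l + m - k)%N; lia.
have pM n : (p * n + 2 * (l * n) = m * n)%N by rewrite -pE mulnDl mulnA.
have qM n : (q * n + k * n = l * n + m * n)%N by rewrite -!mulnDl qE.
(* The target is Z/m in multiplicative notation, with [m] written as a successor. *)
pose f (i : 'I_3) : 'I_m.-1.+1 := inZp (nth 0 [:: (k + l)%N; p; q] i).
have fR u v : fib_rel k l u v -> weval f u = weval f v.
  case=> i [-> ->]; rewrite weval_cat !weval_wpow !Zp_expg.
  apply: val_inj; rewrite /= prednK // modnDm !modnMml.
  have eqm a b c d : (c * m + a = d * m + b)%N -> a = b %[mod m].
    by move=> e; rewrite -(modnMDl c) e modnMDl.
  (* With - 2 l and l - k for [p] and [q], the first relation holds over the integers; in the others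
     the two sides differ by - m and m. *)
  case: i => [[|[|[|//]]] ltm] /=; rewrite -modnDm !modnMml modnDm.
  - by apply: (eqm _ _ l k); have := pM k; have := qM l; lia.
  - by apply: (eqm _ _ 1%N (l + k)%N); have := pM l; have := qM k; lia.
  - by apply: (eqm _ _ 0%N 1%N); have := pM l; have := qM l; lia.
have [F FM Ff] := presgroup_lift fR.
have F1 : F 1 = 1 by apply: (mulgI (F 1)); rewrite -FM !mulg1.
move=> x1; have := Ff (inord 0); rewrite -/(fibx k l (inord 0)) -/(x 0) x1 F1.
(* The image k + l of [x 0] is nonzero modulo [m] because 0 < k + l < m. *)
move=> /(congr1 val) /=; rewrite prednK // inordK //= modn_small; lia.
Qed.

End FibonacciGroup.

Theorem corollary5p5 (k l : nat) (k_gt0 : 0 < k) (l_gt0 : 0 < l)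
    (kl_coprime : coprime k l) :
  [/\ normal_closure [set fibw k l]%classic = derived_subgroup (fibgroup k l),
      fibw k l = 1%g <-> is_abelian (fibgroup k l)
    & ~ torsion_free (fibgroup k l)].
Proof.
have nclE :
    normal_closure [set fibw k l]%classic = derived_subgroup (fibgroup k l).
  have nN := normal_normal_closure [set fibw k l]%classic.
  apply/seteqP; split.
    apply: smallest_sub => [|_ ->]; first exact: normal_derived_subgroup.
    by rewrite fibwE; apply: derived_subgroup_comm.
  apply: derived_subgroup_sub nN.1 _ => g h.
  have nw : normal_closure [set fibw k l]%classic (fibw k l).
    by apply: sub_gen_smallest.
  exact: (fibgroup_commute_mod k_gt0 kl_coprime nN nw g h).
(* Each side says that one of the two equal subgroups is trivial. *)
have wE : fibw k l = 1%g <-> is_abelian (fibgroup k l).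
  by rewrite -normal_closure1 nclE derived_subgroup_abelian.
split=> // tfG.
have w1 : fibw k l = 1 by apply: tfG; exists 2; last exact: fibw_sqr.
apply: (@fibx0_neq1 k l) => //; apply: tfG.
exists (k * (k ^ 2 + 3 * l ^ 2))%N.
  by rewrite muln_gt0 addn_gt0 !expn_gt0 k_gt0.
by apply: fib_triple_finite_order (fibgroup_triple k l) _; apply/wE.
Qed.
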